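(* Let $d\in\mathbb{N}$, $L>0$, $R>0$. There is a constant $C_1$ (which may depend on $L,R$ but is independent of $T$ and $\tau$) such that the following holds for all integers $T\ge 1$ and $\tau\ge 1$. Let $\mathcal{K}\subset\mathbb{R}^d$ be a closed convex set with $0\in\mathcal{K}$ and $\|x\|\le R$ for all $x\in\mathcal{K}$, let $x_u^t\in\mathcal{K}$ and $x_k^t\in\mathbb{R}^d$ with $\|x_k^t\|\le R$ for all $t\ge1$, and let $f_t\in\mathcal{F}$ ($t\ge 1$) be convex, $L$-Lipschitz losses with $\|\nabla f_t(x)\|\le L$ for $x\in\mathcal{K}$. Let $\sigma>0$ and $L'>0$ satisfy $L'=L+\sigma R$ and $\sigma=\frac{R}{L'\sqrt{\tau}}$. Run the Delayed Correlated Online Gradient Descent algorithm with delay $\tau$, influence functions $\Phi_{t+1}(x)=\lambda_{t+1}x$, and parameters $$\eta_t=\beta_t=|\lambda_{t+1}|=\frac{\sigma}{\sqrt{t-\tau}}\quad (t>\tau).$$ Then its cumulative regret $R(T)=\sum_{t=1}^T f_t(\hat{x}_u^t)-\min_{x\in\mathcal{K}}\sum_{t=1}^T f_t(x)$ satisfies $$R(T)\le C_1\sqrt{\tau T}.$$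
   Context: $\|\cdot\|$ is the Euclidean norm on $\mathbb{R}^d$. At each round $t$ an agent has a known context $x_k^t\in\mathbb{R}^d$ and an unknown context $x_u^t\in\mathbb{R}^d$, the latter revealed only after a fixed delay of $\tau$ rounds; both sequences are arbitrary. Class $\mathcal{F}$: the convex functions $f_t:\mathbb{R}^d\to[0,\infty)$ of the form $f_t(x)=f(\|x-x_u^t\|)$, where $f:[0,\infty)\to[0,\infty)$ (possibly depending on $t$) is increasing with $f(0)=0$. $\nabla f_t(x)$ denotes the gradient (a subgradient where $f_t$ is not differentiable). Delayed Correlated Online Gradient Descent. Inputs: step sizes $\eta_t$, delay $\tau$, influence functions $\Phi_t:\mathbb{R}^d\to\mathbb{R}^d$, weights $\beta_t$. Set $\hat{x}_u^1=\dots=\hat{x}_u^{\tau}=\hat{x}_u^{\tau+1}=0$. For $t\ge\tau+1$: incur loss $f_t(\hat{x}_u^t)$; compute $g_{t-\tau}=\nabla f_{t-\tau}(\hat{x}_u^{t-\tau})$; update $$\hat{x}_u^{t+1}=\hat{x}_u^t-\eta_t g_{t-\tau}+\beta_t\Phi_{t+1}(x_k^{t+1}),$$ and, if this point lies outside $\mathcal{K}$, replace it by its Euclidean projection onto $\mathcal{K}$. The signs of the $\lambda_{t+1}$ are arbitrary. *)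

(* Defs.v *)
From mathcomp Require Export all_boot all_order all_algebra.
From mathcomp Require Export all_classical all_reals all_analysis.

Set Implicit Arguments.
Unset Strict Implicit.
Unset Printing Implicit Defensive.
Import Order.TTheory GRing.Theory Num.Theory.
Export numFieldNormedType.Exports.

Local Open Scope classical_set_scope.
Local Open Scope ring_scope.

Definition dot (R : realType) (d : nat) (u v : 'rV[R]_d) : R :=
  \sum_(i < d) u 0 i * v 0 i.

(* The library norm `|x| on 'rV[R]_d is the sup norm; the Euclidean norm is
   defined separately.  Both induce the same topology, so the library's [closed]
   and [differentiable] have their usual Euclidean meaning. *)
Definition enorm (R : realType) (d : nat) (x : 'rV[R]_d) : R :=
  Num.sqrt (dot x x).

Definition elipschitz (R : realType) (d : nat) (L : R) (f : 'rV[R]_d -> R) :=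
  forall x y, `|f x - f y| <= L * enorm (x - y).

Definition subgradient (R : realType) (d : nat) (f : 'rV[R]_d -> R)
    (x g : 'rV[R]_d) :=
  forall y, f x + dot g (y - x) <= f y.

(* [g] is an admissible value of "nabla f (x)": the gradient where [f] is
   differentiable, any subgradient elsewhere. *)
Definition is_nabla (R : realType) (d : nat) (f : 'rV[R]_d -> R)
    (x g : 'rV[R]_d) :=
  (differentiable f x -> forall v, 'd f x v = dot g v) /\
  (~ differentiable f x -> subgradient f x g).

(* The class of losses for the unknown context [xu].  The profile [phi] is a
   function on [0, +oo[, so only its values there are constrained. *)
Definition radial_loss (R : realType) (d : nat) (xu : 'rV[R]_d)
    (f : 'rV[R]_d -> R) :=
  convex_function [set: 'rV[R]_d] f /\
  exists phi : R -> R,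
    [/\ forall s, 0 <= s -> 0 <= phi s,
        forall s t, 0 <= s -> s <= t -> phi s <= phi t,
        phi 0 = 0 &
        forall x, f x = phi (enorm (x - xu))].

Definition is_projection (R : realType) (d : nat) (K : set 'rV[R]_d)
    (y p : 'rV[R]_d) :=
  K p /\ forall z, K z -> enorm (y - p) <= enorm (y - z).

(* [xhat] is the sequence of iterates of Delayed Correlated Online Gradient
   Descent.  Rounds are numbered from 1: index 0 of every sequence is unused.
   [nabla t x] is the (sub)gradient of the loss of round [t] at [x]. *)
Definition dcogd (R : realType) (d : nat) (K : set 'rV[R]_d) (tau : nat)
    (eta beta : nat -> R) (Phi : nat -> 'rV[R]_d -> 'rV[R]_d)
    (xk : nat -> 'rV[R]_d) (nabla : nat -> 'rV[R]_d -> 'rV[R]_d)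
    (xhat : nat -> 'rV[R]_d) :=
  (forall t, (1 <= t <= tau.+1)%N -> xhat t = 0) /\
  (forall t, (tau.+1 <= t)%N ->
    let g := nabla (t - tau)%N (xhat (t - tau)%N) in
    let y := xhat t - eta t *: g + beta t *: Phi t.+1 (xk t.+1) in
    (K y -> xhat t.+1 = y) /\ (~ K y -> is_projection K y (xhat t.+1))).

Definition is_regret (R : realType) (d : nat) (K : set 'rV[R]_d)
    (f : nat -> 'rV[R]_d -> R) (xhat : nat -> 'rV[R]_d) (T : nat) (r : R) :=
  exists xmin,
    [/\ K xmin,
        forall x, K x ->
          \sum_(1 <= t < T.+1) f t xmin <= \sum_(1 <= t < T.+1) f t x &
        r = \sum_(1 <= t < T.+1) f t (xhat t)
            - \sum_(1 <= t < T.+1) f t xmin].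

(* Main.v *)
(* The perturbation is absorbed in the gradient: the update is a projected step
   x_{t+1} = P_K (x_t - eta_t h_t) with h_t = g_{t-tau} - lambda_{t+1} x_k^{t+1}
   and |h_t| <= L'.  For a round s and t = s + tau, the regret against z is at most
     <g_s, x_s - z> = <h_t, x_t - z> + lambda_{t+1} <x_k^{t+1}, x_t - z>
                      + <g_s, x_s - x_t>.
   The first term telescopes as in undelayed gradient descent (Abel summation),
   the second is O(sigma / sqrt s), and the third is controlled by the drift of
   the iterates over tau rounds, each moving by at most sigma L' / sqrt (t - tau).
   The choice sigma L' sqrt tau = rad balances the three contributions. *)
Require Import Defs.
From mathcomp Require Import ring lra.

Set Implicit Arguments.
Unset Strict Implicit.
Unset Printing Implicit Defensive.
Import Order.TTheory GRing.Theory Num.Theory.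
Local Open Scope classical_set_scope.
Local Open Scope ring_scope.

(** * Euclidean inner product and norm *)

Lemma dotC (R : realType) (d : nat) (u v : 'rV[R]_d) : dot u v = dot v u.
Proof. by apply: eq_bigr => i _; rewrite mulrC. Qed.

Lemma dotDl (R : realType) (d : nat) (u v w : 'rV[R]_d) :
  dot (u + v) w = dot u w + dot v w.
Proof.
by rewrite /dot -big_split; apply: eq_bigr => i _; rewrite mxE mulrDl.
Qed.

Lemma dotZl (R : realType) (d : nat) (a : R) (u v : 'rV[R]_d) :
  dot (a *: u) v = a * dot u v.
Proof. by rewrite /dot mulr_sumr; apply: eq_bigr => i _; rewrite mxE mulrA. Qed.

Lemma dotNl (R : realType) (d : nat) (u v : 'rV[R]_d) : dot (- u) v = - dot u v.
Proof. by rewrite -scaleN1r dotZl mulN1r. Qed.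

Lemma dotDr (R : realType) (d : nat) (u v w : 'rV[R]_d) :
  dot u (v + w) = dot u v + dot u w.
Proof. by rewrite dotC dotDl !(dotC u). Qed.

Lemma dotZr (R : realType) (d : nat) (a : R) (u v : 'rV[R]_d) :
  dot u (a *: v) = a * dot u v.
Proof. by rewrite dotC dotZl dotC. Qed.

Lemma dotNr (R : realType) (d : nat) (u v : 'rV[R]_d) : dot u (- v) = - dot u v.
Proof. by rewrite dotC dotNl dotC. Qed.

Definition dotE := (dotDl, dotDr, dotNl, dotNr, dotZl, dotZr).

Lemma dot_ge0 (R : realType) (d : nat) (u : 'rV[R]_d) : 0 <= dot u u.
Proof. by apply: sumr_ge0 => i _; rewrite -expr2 sqr_ge0. Qed.

Lemma enorm_ge0 (R : realType) (d : nat) (u : 'rV[R]_d) : 0 <= enorm u.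
Proof. exact: sqrtr_ge0. Qed.

Lemma sqr_enorm (R : realType) (d : nat) (u : 'rV[R]_d) :
  enorm u ^+ 2 = dot u u.
Proof. by rewrite sqr_sqrtr ?dot_ge0. Qed.

Lemma enorm0 (R : realType) (d : nat) : enorm (0 : 'rV[R]_d) = 0.
Proof. by rewrite /enorm -(scale0r 0) dotZl mul0r sqrtr0. Qed.

Lemma enormZ (R : realType) (d : nat) (a : R) (u : 'rV[R]_d) :
  enorm (a *: u) = `|a| * enorm u.
Proof.
by rewrite /enorm !dotE mulrA -expr2 sqrtrM ?sqr_ge0 // sqrtr_sqr.
Qed.

Lemma enormN (R : realType) (d : nat) (u : 'rV[R]_d) : enorm (- u) = enorm u.
Proof. by rewrite -scaleN1r enormZ normrN1 mul1r. Qed.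

Lemma enorm_eq0 (R : realType) (d : nat) (u : 'rV[R]_d) : enorm u = 0 -> u = 0.
Proof.
move=> u0; have := sqr_enorm u; rewrite u0 expr0n /= => /esym dotu0.
apply/rowP => i; rewrite mxE.
have := psumr_eq0P (fun i _ => sqr_ge0 (u 0 i)) dotu0.
by move=> /(_ i isT) /eqP; rewrite sqrf_eq0 => /eqP.
Qed.

(** Cauchy-Schwarz: for nonzero vectors, expanding the square of [enorm v *: u - enorm u *: v]
    leaves twice [enorm u * enorm v * (enorm u * enorm v - dot u v)]. *)
Lemma dot_le_enorm (R : realType) (d : nat) (u v : 'rV[R]_d) :
  dot u v <= enorm u * enorm v.
Proof.
have [u0|u0] := eqVneq (enorm u) 0.
  by rewrite u0 mul0r (enorm_eq0 u0) -(scale0r 0) dotZl mul0r.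
have [v0|v0] := eqVneq (enorm v) 0.
  by rewrite v0 mulr0 (enorm_eq0 v0) -(scale0r 0) dotZr mul0r.
have upos : 0 < enorm u by rewrite lt_def u0 enorm_ge0.
have vpos : 0 < enorm v by rewrite lt_def v0 enorm_ge0.
have := dot_ge0 (enorm v *: u - enorm u *: v).
rewrite !dotE (dotC v u) -!sqr_enorm => h.
have : 0 <= (enorm u * enorm v) * (enorm u * enorm v - dot u v) by nra.
by rewrite pmulr_rge0 ?mulr_gt0 // subr_ge0.
Qed.

Lemma enormD (R : realType) (d : nat) (u v : 'rV[R]_d) :
  enorm (u + v) <= enorm u + enorm v.
Proof.
rewrite -(ler_pXn2r (ltn0Sn 1)) ?nnegrE ?addr_ge0 ?enorm_ge0 //.
have := dot_le_enorm u v.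
rewrite sqr_enorm !dotE (dotC v u) -!sqr_enorm; nra.
Qed.

(** * Convexity, projections and subgradients *)

Lemma conv_lmodE (R : realType) (d : nat) (x y : 'rV[R]_d) (s : {i01 R}) :
  conv s (y : convex_lmodType 'rV[R]_d) x = x + s%:num *: (y - x).
Proof.
rewrite /conv /= /unstable.onem scalerBl scale1r scalerBr.
by rewrite addrCA.
Qed.

Lemma convex_set_segment (R : realType) (d : nat) (K : set 'rV[R]_d)
    (x y : 'rV[R]_d) (s : R) :
  convex_set K -> K x -> K y -> 0 <= s -> s <= 1 -> K (x + s *: (y - x)).
Proof.
move=> cvxK Kx Ky s0 s1.
have := cvxK y x (Itv01 s0 s1) (mem_set Ky) (mem_set Kx).
by rewrite inE conv_lmodE.
Qed.

Lemma convex_function_segment (R : realType) (d : nat) (f : 'rV[R]_d -> R)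
    (x y : 'rV[R]_d) (s : R) :
  convex_function [set: 'rV[R]_d] f -> 0 <= s -> s <= 1 ->
  f (x + s *: (y - x)) <= f x + s * (f y - f x).
Proof.
move=> cvxf s0 s1.
have := cvxf (Itv01 s0 s1) y x (mem_set I) (mem_set I).
rewrite conv_lmodE convRE /= => /le_trans; apply.
by rewrite /unstable.onem; lra.
Qed.

(** Since [y - p] and [z - p] have nonpositive inner product, expanding the square of
    [y - z = (y - p) - (z - p)] gives at least the square of [p - z]. *)
Lemma projection_le (R : realType) (d : nat) (K : set 'rV[R]_d)
    (y p z : 'rV[R]_d) :
  convex_set K -> is_projection K y p -> K z -> enorm (p - z) <= enorm (y - z).
Proof.
move=> cvxK [Kp minp] Kz.
(* Moving from p towards z would otherwise get closer to y; s = c / (b + c) is a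
   small enough step. *)
have obtuse : dot (y - p) (z - p) <= 0.
  rewrite leNgt; apply/negP => c0.
  pose b := dot (z - p) (z - p).
  have b0 : 0 <= b := dot_ge0 _.
  pose c := dot (y - p) (z - p).
  have c1 : 0 < c := c0.
  pose s := c / (b + c).
  have bc : 0 < b + c by rewrite ltr_wpDl.
  have s0 : 0 < s by rewrite divr_gt0.
  have s1 : s <= 1 by rewrite ler_pdivrMr // mul1r lerDr.
  have /minp := convex_set_segment cvxK Kp Kz (ltW s0) s1.
  rewrite -(ler_pXn2r (ltn0Sn 1)) ?nnegrE ?enorm_ge0 // !sqr_enorm.
  rewrite opprD addrA.
  rewrite [leRHS]dotDl !(dotDr _ (y - p)) !(dotNl, dotNr, dotZl, dotZr).
  rewrite -/b (dotC (z - p)) -/c => h.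
  have sbc : s * (b + c) = c by rewrite /s divfK // gt_eqF.
  (* This is minimality of [p]; as [s * b = c - s * c], the bracket equals [c + s * c], which is
     positive. *)
  have : s * (2 * c - s * b) <= 0 by lra.
  rewrite pmulr_rle0 // => h2.
  have := mulr_gt0 s0 c1; lra.
rewrite -(ler_pXn2r (ltn0Sn 1)) ?nnegrE ?enorm_ge0 // !sqr_enorm.
have -> : y - z = (y - p) - (z - p) by rewrite opprB addrA subrK.
rewrite -(opprB z p) [leRHS]dotDl !(dotDr _ (y - p)) !(dotNl, dotNr).
rewrite (dotC (z - p) (y - p)).
by have := dot_ge0 (y - p); lra.
Qed.

(** At a point of differentiability, convexity bounds the difference quotients in direction [y - x]
    with step [0 < h <= 1] by [f y - f x]; the bound survives the limit as [h] tends to 0 from the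
    right. *)
Lemma convex_nabla_subgradient (R : realType) (d : nat) (f : 'rV[R]_d -> R)
    (x g : 'rV[R]_d) :
  convex_function [set: 'rV[R]_d] f -> is_nabla f x g -> subgradient f x g.
Proof.
move=> cvxf [nab_diff nab_sub].
have [df|] := pselect (differentiable f x); last exact: nab_sub.
move=> y; rewrite -lerBrDl -(nab_diff df) -deriveE //.
have /cvg_dnbhs_at_right := @diff_derivable _ _ _ _ _ (y - x) df.
move=> /cvgr_to_le; apply; near=> h.
have h0 : 0 < h by near: h; exact: nbhs_right_gt.
have h1 : h <= 1 by near: h; exact: nbhs_right_le.
rewrite [leLHS]/(_ * _) ler_pdivrMl // lerBlDl /= addrC.
exact: convex_function_segment (ltW h0) h1.
Unshelve. all: by end_near.
Qed.

(** * Comparison with the sup norm, and existence of a minimiser *)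

Lemma entry_le_enorm (R : realType) (d : nat) (x : 'rV[R]_d) (i : 'I_d) :
  `|x 0 i| <= enorm x.
Proof.
rewrite -(ler_pXn2r (ltn0Sn 1)) ?nnegrE ?enorm_ge0 // sqr_enorm.
rewrite real_normK ?num_real // /dot (bigD1 i) //= -expr2 lerDl.
by apply: sumr_ge0 => j _; rewrite -expr2 sqr_ge0.
Qed.

Lemma norm_le_enorm (R : realType) (d : nat) (x : 'rV[R]_d) : `|x| <= enorm x.
Proof.
rewrite [leLHS]/Num.norm /= mx_normrE; apply/bigmax_leP; split => [|[i j] _ /=].
  exact: enorm_ge0.
by rewrite ord1 entry_le_enorm.
Qed.

Lemma enorm_le_norm (R : realType) (d : nat) (x : 'rV[R]_d) :
  enorm x <= Num.sqrt d%:R * `|x|.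
Proof.
rewrite -(ler_pXn2r (ltn0Sn 1)) ?nnegrE ?mulr_ge0 ?sqrtr_ge0 //.
rewrite sqr_enorm exprMn sqr_sqrtr // /dot.
apply: le_trans (_ : \sum_(i < d) `|x| ^+ 2 <= _); last first.
  by rewrite sumr_const card_ord mulr_natl.
apply: ler_sum => i _; rewrite -expr2 -[leLHS]real_normK ?num_real //.
rewrite ler_pXn2r ?nnegrE // [leRHS]/Num.norm /= mx_normrE.
exact: (le_bigmax _ (fun ij => `|x ij.1 ij.2|) (0, i)).
Qed.

Lemma elipschitz_continuous (R : realType) (d : nat) (L : R)
    (f : 'rV[R]_d -> R) : 0 <= L -> elipschitz L f -> continuous f.
Proof.
move=> L0 lipf x; apply/(@cvgrPdist_le _ _ _ (nbhs x) _ f (f x)) => /= e e0.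
(* The added 1 keeps [c] positive even when [L] or [d] is 0. *)
pose c := L * Num.sqrt d%:R + 1.
have c0 : 0 < c by rewrite ltr_wpDl // mulr_ge0 ?sqrtr_ge0.
near=> y.
have xy : `|x - y| <= e / c.
  have : ball x (e / c) y.
    by near: y; apply: nbhsx_ballx; rewrite divr_gt0.
  by rewrite -ball_normE => /ltW.
apply: le_trans (lipf x y) _.
apply: le_trans (ler_wpM2l L0 (enorm_le_norm _)) _.
rewrite mulrA; apply: (@le_trans _ _ (c * `|x - y|)).
  by rewrite ler_wpM2r // /c lerDl.
by rewrite -ler_pdivlMl // mulrC.
Unshelve. all: by end_near.
Qed.

(** Supplies the comparator of the regret: [K] is closed and bounded in finite dimension, hence
    compact, and the total loss is continuous. *)
Lemma elipschitz_sum_min (R : realType) (d : nat) (K : set 'rV[R]_d) (L r : R)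
    (f : nat -> 'rV[R]_d -> R) (T : nat) :
  0 <= L -> closed K -> K !=set0 -> (forall x, K x -> enorm x <= r) ->
  (forall t, (1 <= t)%N -> elipschitz L (f t)) ->
  exists2 z, K z & forall x, K x ->
    \sum_(1 <= t < T.+1) f t z <= \sum_(1 <= t < T.+1) f t x.
Proof.
move=> L0 clK K0 Kr lipf.
have cptK : compact K.
  apply: bounded_closed_compact => //; exists r; split; first exact: num_real.
  move=> M rM x Kx; apply: le_trans (norm_le_enorm x) _.
  exact: le_trans (Kr _ Kx) (ltW rM).
have cf : continuous (fun x => \sum_(1 <= t < T.+1) f t x).
  (* Puts the range into the summation condition, since the losses are Lipschitz only for
     [1 <= t]. *)
  under eq_fun do rewrite big_nat.
  apply: continuous_big; first exact: add_continuous.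
  by move=> t /andP[t1 _]; exact: elipschitz_continuous (lipf t t1).
have [z /set_mem Kz minz] := EVT_min_rV K0 cptK (continuous_subspaceT cf).
by exists z => // x Kx; exact/minz/mem_set.
Qed.

(** * Summation bounds and single-step estimates *)

(* For s <= k the subtraction truncates to 0 and the summand is 0^-1 = 0: the
   iterates do not move during the first rounds. *)
Lemma sum_invsqrt_le (R : realType) (k T : nat) :
  \sum_(1 <= s < T.+1) (Num.sqrt (s - k)%:R)^-1 <= 2 * Num.sqrt (T - k)%:R :> R.
Proof.
elim: T => [|T IH]; first by rewrite big_geq // mulr_ge0 ?sqrtr_ge0.
rewrite big_nat_recr //=; have [Tk|kT] := leqP T.+1 k.
  have Tk0 : (T - k = 0)%N by apply/eqP; rewrite subn_eq0 ltnW.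
  move: Tk; rewrite -subn_eq0 => /eqP Tk.
  by move: IH; rewrite Tk Tk0 !sqrtr0 invr0 addr0.
rewrite subSn //; move: IH; set n := (T - k)%N => IH.
apply: le_trans (lerD IH (lexx _)) _.
have b0 : 0 < Num.sqrt n.+1%:R :> R by rewrite sqrtr_gt0.
have a0 : 0 <= Num.sqrt n%:R :> R := sqrtr_ge0 _.
have a2 : Num.sqrt n%:R ^+ 2 = n%:R :> R by rewrite sqr_sqrtr.
have b2 : Num.sqrt n.+1%:R ^+ 2 = n%:R + 1 :> R by rewrite sqr_sqrtr // natr1.
move: (Num.sqrt n%:R) (Num.sqrt n.+1%:R) a0 b0 a2 b2 => a b a0 b0 a2 b2.
rewrite -lerBrDl -[b^-1]mul1r ler_pdivrMr //.
(* With [b ^+ 2 = a ^+ 2 + 1], this square is exactly [2 * (b - a) * b - 1]. *)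
have : 0 <= (b - a) ^+ 2 by rewrite sqr_ge0.
nra.
Qed.

Lemma abel_sum_le (R : realType) (D w : nat -> R) (B : R) (T : nat) :
  (forall s, (1 <= s)%N -> 0 <= D s <= B) -> (forall s, 0 <= w s) ->
  (forall s, w s <= w s.+1) ->
  \sum_(1 <= s < T.+1) (D s - D s.+1) * w s <= B * w T.
Proof.
move=> DB w0 wS.
(* Keeping the boundary term makes the induction work: the step reduces to
   [(B - D T.+1) * (w T.+1 - w T) >= 0]. *)
suff : \sum_(1 <= s < T.+1) (D s - D s.+1) * w s <= (B - D T.+1) * w T.
  move/le_trans; apply; rewrite ler_wpM2r // gerBl.
  by have /andP[] := DB T.+1 isT.
elim: T => [|T IH].
  by rewrite big_geq // mulr_ge0 // subr_ge0; have /andP[] := DB 1%N isT.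
rewrite big_nat_recr //=; apply: le_trans (lerD IH (lexx _)) _.
have /andP[_ h] := DB T.+1 isT; have := wS T; nra.
Qed.

(** Expand the square of [x - z - eta *: h] and solve for the inner product. Only a distance
    inequality is asked of [x'], so projected and unprojected steps are both covered. *)
Lemma gd_step_le (R : realType) (d : nat) (x x' z h : 'rV[R]_d) (eta G : R) :
  0 < eta -> enorm h <= G -> enorm (x' - z) <= enorm (x - eta *: h - z) ->
  dot h (x - z) <=
    (enorm (x - z) ^+ 2 - enorm (x' - z) ^+ 2) / (2 * eta) + eta / 2 * G ^+ 2.
Proof.
move=> eta0 hG; rewrite -(ler_pXn2r (ltn0Sn 1)) ?nnegrE ?enorm_ge0 //.
have hG2 : enorm h ^+ 2 <= G ^+ 2.
  by rewrite ler_pXn2r // nnegrE ?enorm_ge0 // (le_trans (enorm_ge0 h)).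
have -> : x - eta *: h - z = (x - z) - eta *: h by rewrite addrAC.
rewrite (sqr_enorm (_ - eta *: h)) [dot (_ - _) _]dotDl !(dotDr _ (x - z)).
rewrite !(dotNl, dotNr, dotZl, dotZr) (dotC (x - z) h) -!sqr_enorm => step.
rewrite -lerBlDr ler_pdivlMr ?mulr_gt0 //.
have : eta ^+ 2 * enorm h ^+ 2 <= eta ^+ 2 * G ^+ 2.
  by rewrite ler_wpM2l // sqr_ge0.
lra.
Qed.

Lemma enorm_drift_le (R : realType) (d : nat) (x : nat -> 'rV[R]_d)
    (s n : nat) :
  enorm (x s - x (s + n)%N) <= \sum_(j < n) enorm (x (s + j).+1 - x (s + j)%N).
Proof.
elim: n => [|n IH]; first by rewrite addn0 subrr enorm0 big_ord0.
rewrite big_ord_recr /= addnS.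
have -> : x s - x (s + n).+1
    = (x s - x (s + n)%N) - (x (s + n).+1 - x (s + n)%N).
  by rewrite opprB addrA subrK.
by apply: le_trans (enormD _ _) _; rewrite enormN lerD2r.
Qed.

(** * The regret bound *)

Theorem theorem1 (R : realType) (d : nat) (L rad : R) (L_gt0 : 0 < L)
    (rad_gt0 : 0 < rad) :
  exists C1 : R,
  forall (T tau : nat), (1 <= T)%N -> (1 <= tau)%N ->
  forall K : set 'rV[R]_d,
    closed K -> convex_set K -> K 0 ->
    (forall x, K x -> enorm x <= rad) ->
  forall xu xk : nat -> 'rV[R]_d,
    (forall t, (1 <= t)%N -> K (xu t)) ->
    (forall t, (1 <= t)%N -> enorm (xk t) <= rad) ->
  forall (f : nat -> 'rV[R]_d -> R) (nabla : nat -> 'rV[R]_d -> 'rV[R]_d),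
    (forall t, (1 <= t)%N -> radial_loss (xu t) (f t)) ->
    (forall t, (1 <= t)%N -> elipschitz L (f t)) ->
    (forall t, (1 <= t)%N -> forall x, is_nabla (f t) x (nabla t x)) ->
    (forall t, (1 <= t)%N -> forall x, K x -> enorm (nabla t x) <= L) ->
  forall sigma L' : R,
    0 < sigma -> 0 < L' ->
    L' = L + sigma * rad ->
    sigma = rad / (L' * Num.sqrt tau%:R) ->
  forall eta beta lambda : nat -> R,
    (forall t, (tau < t)%N -> eta t = sigma / Num.sqrt (t - tau)%:R) ->
    (forall t, (tau < t)%N -> beta t = sigma / Num.sqrt (t - tau)%:R) ->
    (forall t, (tau < t)%N ->
      `|lambda t.+1| = sigma / Num.sqrt (t - tau)%:R) ->
  forall xhat : nat -> 'rV[R]_d,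
    dcogd K tau eta beta (fun t x => lambda t *: x) xk nabla xhat ->
  exists2 regret : R,
    is_regret K f xhat T regret & regret <= C1 * Num.sqrt (tau * T)%:R.
Proof.
(* [M] bounds [L'] independently of [tau], because [sigma <= rad / L]. In the constant below,
   [3 * rad * M] collects the telescoping and squared-step terms, [4 * rad ^+ 3 / L] the known
   contexts, and [2 * L * rad] the delay. *)
pose M := L + rad ^+ 2 / L.
exists (3 * rad * M + 4 * rad ^+ 3 / L + 2 * L * rad).
move=> T tau T1 tau1 K clK cvxK K0 Krad xu xk Kxu xk_rad f nabla radf lipf nab.
move=> nab_le sigma L' sigma0 L'0 L'E sigmaE eta beta lambda etaE betaE lambdaE.
move=> x [x_init x_step].
have [z Kz minz] := elipschitz_sum_min T (ltW L_gt0) clK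
  (ex_intro _ 0 K0) Krad lipf.
exists (\sum_(1 <= t < T.+1) f t (x t) - \sum_(1 <= t < T.+1) f t z).
  by exists z.
pose v n : R := (Num.sqrt n%:R)^-1.
have v0 n : 0 <= v n by rewrite invr_ge0 sqrtr_ge0.
have eta_gt0 t : (tau < t)%N -> 0 < eta t.
  by move=> taut; rewrite etaE // divr_gt0 // sqrtr_gt0 ltr0n subn_gt0.
have lambda_le t : (tau < t)%N -> `|lambda t.+1| <= sigma.
  move=> taut; rewrite lambdaE // ler_pdivrMr; last first.
    by rewrite sqrtr_gt0 ltr0n subn_gt0.
  rewrite ler_peMr ?(ltW sigma0) // -[leLHS]sqrtr1 ler_wsqrtr //.
  by rewrite ler1n subn_gt0.
pose h t := nabla (t - tau)%N (x (t - tau)%N) - lambda t.+1 *: xk t.+1.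
have x_next t : (tau < t)%N -> K (x t.+1) /\
    forall w, K w -> enorm (x t.+1 - w) <= enorm (x t - eta t *: h t - w).
  move=> taut; have [] := x_step t taut.
  (* Equality of [beta t] and [eta t] is what lets the perturbation merge into the gradient. *)
  have -> : x t - eta t *: nabla (t - tau)%N (x (t - tau)%N)
      + beta t *: (lambda t.+1 *: xk t.+1) = x t - eta t *: h t.
    by rewrite /h betaE // -etaE // [in RHS]scalerBr opprB [in RHS]addrA addrAC.
  have [Ky|nKy] := pselect (K (x t - eta t *: h t)).
    by move=> /(_ Ky) -> _; split.
  move=> _ /(_ nKy) prj; split=> [|w Kw]; first by case: prj.
  exact: projection_le Kw.
have Kx t : (1 <= t)%N -> K (x t).
  move=> t1; have [ttau|taut] := leqP t tau.+1.
    by rewrite x_init ?t1.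
  by case: t taut {t1} => // t taut; case: (x_next t taut).
have h_le t : (tau < t)%N -> enorm (h t) <= L'.
  move=> taut; apply: le_trans (enormD _ _) _; rewrite enormN enormZ L'E.
  apply: lerD.
    by apply: nab_le; rewrite ?subn_gt0 //; apply: Kx; rewrite subn_gt0.
  by apply: ler_pM; rewrite ?enorm_ge0 ?lambda_le ?xk_rad.
have move_le t : (1 <= t)%N ->
    enorm (x t.+1 - x t) <= sigma * L' * v (t - tau)%N.
  (* For [t <= tau] both iterates are 0, as the initialisation extends to index [tau.+1]. *)
  move=> t1; have [ttau|taut] := leqP t tau.
    rewrite !x_init ?t1 ?(leqW ttau) // subrr enorm0.
    by rewrite !mulr_ge0 ?(ltW sigma0) ?(ltW L'0).
  (* Taking the point [x t] of [K] itself as reference bounds the move by [eta t * enorm (h t)]. *)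
  have [_ /(_ _ (Kx t t1)) /le_trans] := x_next t taut; apply.
  rewrite addrAC subrr add0r enormN enormZ gtr0_norm ?eta_gt0 // etaE //.
  by rewrite [leRHS]mulrAC ler_wpM2l ?h_le // mulr_ge0 // ltW.
have xz_le t : (1 <= t)%N -> enorm (x t - z) <= 2 * rad.
  move=> t1; apply: le_trans (enormD _ _) _; rewrite enormN.
  by rewrite mulr2n mulrDl mul1r; apply: lerD; apply: Krad => //; exact: Kx.
pose D t := enorm (x t - z) ^+ 2.
(* The gradient of round [s] is applied at round [s + tau], whose step size is [sigma / Num.sqrt s].
   The summands come from the distance decrease, from the squared step together with the known
   context, and from the drift. *)
have round_le s : (1 <= s)%N -> f s (x s) - f s z <=
    (D (s + tau)%N - D (s + tau).+1) * (Num.sqrt s%:R / (2 * sigma))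
    + (sigma / 2 * L' ^+ 2 + 2 * rad ^+ 2 * sigma) * v s
    + L * \sum_(j < tau) (sigma * L' * v (s + j - tau)%N).
  move=> s1; set t := (s + tau)%N; set g := nabla s (x s).
  have taut : (tau < t)%N by rewrite /t addnC -addn1 leq_add2l.
  have ts : (t - tau = s)%N by rewrite addnK.
  have t1 : (1 <= t)%N by rewrite (leq_trans _ taut).
  have /(_ z) := convex_nabla_subgradient (proj1 (radf s s1)) (nab s s1 (x s)).
  rewrite -/g => sub.
  have -> : (D t - D t.+1) * (Num.sqrt s%:R / (2 * sigma))
      = (D t - D t.+1) / (2 * eta t).
    rewrite etaE // ts; congr (_ * _).
    by rewrite [in RHS]mulrA invf_div.
  have := gd_step_le (eta_gt0 t taut) (h_le t taut) ((x_next t taut).2 z Kz).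
  have -> : dot (h t) (x t - z)
      = dot g (x t - z) - lambda t.+1 * dot (xk t.+1) (x t - z).
    by rewrite /h ts dotDl dotNl dotZl.
  have lam : lambda t.+1 * dot (xk t.+1) (x t - z) <= 2 * rad ^+ 2 * sigma * v s.
    rewrite -dotZl; apply: le_trans (dot_le_enorm _ _) _.
    rewrite enormZ lambdaE // ts -/(v s).
    have -> : 2 * rad ^+ 2 * sigma * v s = sigma * v s * rad * (2 * rad) by ring.
    apply: ler_pM; rewrite ?mulr_ge0 ?enorm_ge0 ?(ltW sigma0) ?xz_le //.
    by rewrite ler_wpM2l ?xk_rad // mulr_ge0 // ltW.
  have drift : dot g (x s - x t)
      <= L * \sum_(j < tau) (sigma * L' * v (s + j - tau)%N).
    apply: le_trans (dot_le_enorm _ _) _.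
    apply: ler_pM; rewrite ?enorm_ge0 // ?nab_le //; first exact: Kx.
    apply: le_trans (enorm_drift_le _ _ _) _; apply: ler_sum => j _.
    by rewrite move_le // ltn_addr.
  have split_dot : dot g (z - x s) = - (dot g (x t - z) + dot g (x s - x t)).
    by rewrite -dotDr -dotNr [x t - z + _]addrC addrA subrK opprB.
  rewrite etaE // ts -/(v s) -/(D t) -/(D t.+1) => step.
  move: sub; rewrite split_dot.
  by move: (_ / (2 * _)) drift step lam => A; lra.
rewrite -sumrB.
(* [(s + tau).+1] becomes the convertible [s.+1 + tau], exposing differences of a shifted
   sequence. *)
apply: le_trans (_ : \sum_(1 <= s < T.+1) (
    (D (s + tau)%N - D (s.+1 + tau)%N) * (Num.sqrt s%:R / (2 * sigma))
    + (sigma / 2 * L' ^+ 2 + 2 * rad ^+ 2 * sigma) * v s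
    + L * \sum_(j < tau) (sigma * L' * v (s + j - tau)%N)) <= _).
  by rewrite !big_nat; apply: ler_sum => s /andP[s1 _]; exact: round_le.
rewrite 2!big_split /= -2!mulr_sumr exchange_big /=.
have abel : \sum_(1 <= s < T.+1)
      (D (s + tau)%N - D (s.+1 + tau)%N) * (Num.sqrt s%:R / (2 * sigma))
    <= (2 * rad) ^+ 2 * (Num.sqrt T%:R / (2 * sigma)).
  apply: (abel_sum_le (D := fun s => D (s + tau)%N)
                      (w := fun s => Num.sqrt s%:R / (2 * sigma))).
  - move=> s s1; rewrite sqr_ge0 /= ler_pXn2r ?nnegrE ?enorm_ge0 //.
      by rewrite xz_le ?ltn_addr.
    by rewrite mulr_ge0 // ltW.
  - by move=> s; rewrite divr_ge0 ?sqrtr_ge0 // mulr_ge0 // ltW.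
  - move=> s; rewrite ler_wpM2r ?invr_ge0 ?mulr_ge0 ?(ltW sigma0) //.
    by rewrite ler_wsqrtr // ler_nat.
have sum_v : \sum_(1 <= s < T.+1) v s <= 2 * Num.sqrt T%:R.
  by have := sum_invsqrt_le R 0 T; rewrite subn0; under eq_bigr do rewrite subn0.
have sum_delay : \sum_(j < tau) \sum_(1 <= s < T.+1)
      (sigma * L' * v (s + j - tau)%N)
    <= tau%:R * (sigma * L' * (2 * Num.sqrt T%:R)).
  apply: le_trans (_ : \sum_(j < tau) sigma * L' * (2 * Num.sqrt T%:R) <= _);
    last by rewrite sumr_const card_ord [leRHS]mulr_natl.
  apply: ler_sum => j _.
  rewrite -mulr_sumr ler_wpM2l ?mulr_ge0 ?(ltW sigma0) ?(ltW L'0) //.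
  (* As [j < tau], the index [s + j - tau] is [s - (tau - j)]: an inverse square root sum with
     cutoff [tau - j]. *)
  under eq_bigr do rewrite -(subnBA _ (ltnW (ltn_ord j))).
  apply: le_trans (sum_invsqrt_le R (tau - j) T) _.
  by rewrite ler_wpM2l // ler_wsqrtr // ler_nat leq_subr.

(* Constants uniform in the delay *)
set a := Num.sqrt tau%:R in sigmaE *.
set b := Num.sqrt T%:R in abel sum_v sum_delay *.
have -> : Num.sqrt (tau * T)%:R = a * b by rewrite natrM sqrtrM.
have a2 : tau%:R = a ^+ 2 by rewrite sqr_sqrtr.
have a1 : 1 <= a by rewrite -[leLHS]sqrtr1 ler_wsqrtr // ler1n.
have b0 : 0 <= b := sqrtr_ge0 _.
have sLa : sigma * L' * a = rad.
  by rewrite sigmaE; field; rewrite (gt_eqF L'0) gt_eqF // (lt_le_trans _ a1).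
have sL_le : sigma * L' <= rad.
  by rewrite -sLa ler_peMr // mulr_ge0 // ltW.
have sigma_le : sigma <= rad / L.
  rewrite ler_pdivlMr //; apply: le_trans sL_le.
  by rewrite ler_wpM2l ?(ltW sigma0) // L'E lerDl mulr_ge0 // ltW.
have L'_le : L' <= M.
  by rewrite /M L'E lerD2l expr2 mulrAC ler_wpM2r // ltW.
have b_le : b <= a * b by rewrite ler_peMl.
have ab0 : 0 <= a * b by rewrite mulr_ge0 // (le_trans ler01).
(* The factor [1 / sigma] is traded for [L' * a / rad] through [sLa]. *)
have abel_le : (2 * rad) ^+ 2 * (b / (2 * sigma)) <= 2 * rad * M * (a * b).
  have -> : (2 * rad) ^+ 2 * (b / (2 * sigma)) = 2 * rad * L' * (a * b).
    by rewrite -sLa; field; rewrite gt_eqF.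
  by rewrite ler_wpM2r // ler_wpM2l // mulr_ge0 // ltW.
(* These terms are only of order [b]; [b_le] enlarges them to order [a * b]. *)
have step_le : (sigma / 2 * L' ^+ 2 + 2 * rad ^+ 2 * sigma) * (2 * b)
    <= (rad * M + 4 * rad ^+ 3 / L) * (a * b).
  have -> : (sigma / 2 * L' ^+ 2 + 2 * rad ^+ 2 * sigma) * (2 * b)
      = (sigma * L' * L' + 4 * rad ^+ 2 * sigma) * b by field.
  have -> : 4 * rad ^+ 3 / L = 4 * rad ^+ 2 * (rad / L) by rewrite exprSr; ring.
  apply: ler_pM => //.
    by rewrite addr_ge0 ?mulr_ge0 ?sqr_ge0 // ltW.
  apply: lerD; first by apply: ler_pM => //; rewrite ?mulr_ge0 // ltW.
  by rewrite ler_wpM2l // mulr_ge0 // sqr_ge0.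
(* One factor [a] of [tau] is absorbed by [sigma * L' * a = rad], the other remains in the rate. *)
have delay_le : L * (tau%:R * (sigma * L' * (2 * b))) = 2 * L * rad * (a * b).
  by rewrite a2 -sLa; ring.
have := ler_wpM2l (ltW L_gt0) sum_delay; rewrite delay_le.
have c0 : 0 <= sigma / 2 * L' ^+ 2 + 2 * rad ^+ 2 * sigma.
  by rewrite addr_ge0 ?mulr_ge0 ?sqr_ge0 ?invr_ge0 // ltW.
have := ler_wpM2l c0 sum_v.
move=> sum_step sum_drift.
have sum_main := lerD (le_trans abel abel_le) (le_trans sum_step step_le).
have := lerD sum_main sum_drift.
by move/le_trans; apply; lra.
Qed.
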